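(* Let $m,L,r,\nu\ge 1$ and $N\ge 0$ be integers, let $F_0,F_1,\ldots,F_m\in\mathbb S^\nu$ and $M_1,\ldots,M_N\in\mathbb S^\nu$, and let $$\Omega=\Big\{v\in\mathbb R^m:\ \exists\,\xi\in\mathbb R^N,\ F_0+\sum_{i=1}^m v_iF_i+\sum_{t=1}^N\xi_tM_t\succeq 0\Big\}.$$ Let $g_\ell^k$, $\ell=1,\ldots,L$, $k=1,\ldots,r$, be SOS-convex polynomials on $\mathbb R^m$. Assume that $\Omega$ is compact and that there exist $\bar v\in\mathbb R^m$ and $\bar\xi\in\mathbb R^N$ such that $F_0+\sum_{i=1}^m\bar v_iF_i+\sum_{t=1}^N\bar\xi_tM_t\succ 0$. Then the following statements are equivalent. 1. $v\in\Omega\implies \displaystyle\min_{k=1,\ldots,r}\max_{\ell=1,\ldots,L}g_\ell^k(v)\ge 0$. 2. For each $k=1,\ldots,r$ there exist $Z_k\in\mathbb S_+^\nu$ and $\delta^k=(\delta_1^k,\ldots,\delta_L^k)\in\Delta$ such that $$\sum_{\ell=1}^L\delta_\ell^kg_\ell^k(v)-\operatorname{tr}(Z_kF_0)-\sum_{i=1}^mv_i\operatorname{tr}(Z_kF_i)\in\Sigma_d^2(v)\quad\text{and}\quad \operatorname{tr}(Z_kM_t)=0,\ t=1,\ldots,N,$$ where $d$ is the smallest even integer larger than $\max_{k=1,\ldots,r}\max_{\ell=1,\ldots,L}\deg g_\ell^k$.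
   Context: $\mathbb S^\nu$ is the space of real symmetric $\nu\times\nu$ matrices and $\mathbb S_+^\nu$ its cone of positive semi-definite matrices; $M\succeq0$ (resp. $M\succ 0$) means $M$ is positive semi-definite (resp. positive definite). $\Delta=\{\delta\in\mathbb R^L:\delta_\ell\ge0,\ \sum_{\ell=1}^L\delta_\ell=1\}$. A real polynomial in $v\in\mathbb R^m$ is SOS if it is a finite sum of squares of real polynomials; $\Sigma_d^2(v)$ is the set of SOS polynomials in $v$ of degree at most $d$. A real polynomial $f$ on $\mathbb R^m$ is SOS-convex if its Hessian $H(v)$ is an SOS matrix polynomial, i.e. $H(v)=P(v)^\top P(v)$ for some $s\times m$ matrix $P(v)$ with polynomial entries and some $s\in\mathbb N$. *)

(* Defs.v *)
From HB Require Import structures.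
From mathcomp Require Import all_boot all_order all_algebra.
(* mpoly without its notations, which clash with those of mathcomp-analysis *)
From mathcomp Require Import (canonicals, coercions) mpoly.
From mathcomp Require Import all_classical all_reals all_analysis.

Set Implicit Arguments.
Unset Strict Implicit.
Unset Printing Implicit Defensive.

Import Order.TTheory GRing.Theory Num.Theory.
Import numFieldNormedType.Exports.

Local Open Scope classical_set_scope.
Local Open Scope ring_scope.

Notation "{ 'mpoly' T [ n ] }" := (mpoly.mpoly n T) : type_scope.

Definition psdmx (R : realType) (n : nat) (A : 'M[R]_n) : Prop :=
  A \is symmetricmx /\ forall x : 'cV[R]_n, 0 <= (x^T *m A *m x) 0 0.

Definition pdmx (R : realType) (n : nat) (A : 'M[R]_n) : Prop :=
  A \is symmetricmx /\
  forall x : 'cV[R]_n, x != 0 -> 0 < (x^T *m A *m x) 0 0.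

Definition simplex (R : realType) (L : nat) : set 'rV[R]_L :=
  [set delta | (forall l, 0 <= delta 0 l) /\ \sum_(l < L) delta 0 l = 1].

(* [mpoly.msize p] is one more than the degree of [p], and 0 for [p = 0];
   the zero polynomial gets degree 0 here. *)
Definition mdegree (R : realType) (m : nat) (p : {mpoly R[m]}) : nat :=
  (mpoly.msize p).-1.

Definition sos (R : realType) (m : nat) (p : {mpoly R[m]}) : Prop :=
  exists s : seq {mpoly R[m]}, p = \sum_(q <- s) q ^+ 2.

Definition sos_deg (R : realType) (m d : nat) : set {mpoly R[m]} :=
  [set p | sos p /\ (mdegree p <= d)%N].

Definition mhessian (R : realType) (m : nat) (f : {mpoly R[m]}) :
    'M[{mpoly R[m]}]_m :=
  \matrix_(i < m, j < m) mpoly.mderiv j (mpoly.mderiv i f).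

Definition sos_mx (R : realType) (m n : nat) (H : 'M[{mpoly R[m]}]_n) : Prop :=
  exists (s : nat) (P : 'M[{mpoly R[m]}]_(s, n)), H = P^T *m P.

Definition sos_convex (R : realType) (m : nat) (f : {mpoly R[m]}) : Prop :=
  sos_mx (mhessian f).

Definition lmi (R : realType) (m N nu : nat) (F0 : 'M[R]_nu)
    (F : 'I_m -> 'M[R]_nu) (M : 'I_N -> 'M[R]_nu)
    (v : 'rV[R]_m) (xi : 'rV[R]_N) : 'M[R]_nu :=
  F0 + \sum_(i < m) v 0 i *: F i + \sum_(t < N) xi 0 t *: M t.

Definition Omega (R : realType) (m N nu : nat) (F0 : 'M[R]_nu)
    (F : 'I_m -> 'M[R]_nu) (M : 'I_N -> 'M[R]_nu) : set 'rV[R]_m :=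
  [set v | exists xi : 'rV[R]_N, psdmx (lmi F0 F M v xi)].

(* [d] is the smallest even integer (strictly) larger than [D]. *)
Definition smallest_even_above (D d : nat) : Prop :=
  [/\ ~~ odd d, (D < d)%N &
      forall e : nat, ~~ odd e -> (D < e)%N -> (d <= e)%N].

(* Main.v *)
Require Import Defs.
From HB Require Import structures.
From mathcomp Require Import all_boot all_order all_algebra.
From mathcomp Require Import (canonicals, coercions) mpoly.
From mathcomp Require Import all_classical all_reals all_analysis.
From mathcomp Require Import ring lra.
From mathcomp Require polyrcf.

Set Implicit Arguments.
Unset Strict Implicit.
Unset Printing Implicit Defensive.

Import Order.TTheory GRing.Theory Num.Theory.
Import numFieldNormedType.Exports.

Local Open Scope classical_set_scope.
Local Open Scope ring_scope.

(** One direction is weak duality: at a point [v] of Omega with witness [xi],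
    the trace terms add up to the trace of [Z] times a positive semidefinite
    matrix, so that [sum_l delta_l g_l(v)] is nonnegative, and hence so is one
    of the [g_l(v)].

    Conversely fix [k] and let [u] minimise [max_l g_l] over the compact set
    Omega, with value [gam >= 0]. First-order optimality at [u] only involves
    linear data: no direction that is feasible for the matrix inequality makes
    all linearised objectives decrease ([no_descent_direction]). Read as the
    positivity of a linear functional on a subspace that, by Slater's
    condition, contains an order unit of a product of cones, it extends to the
    whole space by the Riesz theorem ([riesz_extension]). The coordinates of
    the extension are the weights [delta] and the matrix [Z]: they satisfy the
    stationarity and complementarity relations ([kkt_multipliers]), and these
    identify the polynomial of the certificate with
    [sum_l delta_l (g_l - tangent of g_l at u) + gam].

    It remains to see that an SOS-convex polynomial minus its tangent at a
    point is SOS ([sos_convex_tangent]). By Taylor's formula this difference is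
    the integral over [0, 1] of [(1 - s) q(s)^2], summed over finitely many
    polynomials [q] in [s] whose coefficients are polynomials in the variables.
    The integral is a quadratic form in these coefficients, with a real
    positive semidefinite matrix, and a factorisation of that matrix
    ([psdmx_gram]) displays it as a sum of squares ([remainder_sos]). The
    tangent inequality is also what makes [no_descent_direction] work.

    The degree bound is immediate: the certificate is an affine modification of
    a combination of the [g_l], and [d >= 1]. *)

(** * Extension of positive linear functionals *)

(** The graph of a linear functional on a subspace: extending the functional is
    enlarging the set, and single-valuedness follows from positivity on a convex
    cone. *)
Definition linear_graph (R : realType) (V : lmodType R) (G : set (V * R)) : Prop :=
  G (0, 0) /\
  forall a v r w s, G (v, r) -> G (w, s) -> G (a *: v + w, a * r + s).

Definition convex_cone (R : realType) (V : lmodType R) (K : set V) : Prop :=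
  [/\ K 0, forall v w, K v -> K w -> K (v + w) &
      forall a v, 0 <= a -> K v -> K (a *: v)].

(** One more vector [y] can always be put in the domain. Its value has to lie
    above all [r] with [y - v] in the cone and below all [s] with [w - y] in
    the cone, where [r] and [s] are the values at [v] and [w]. Positivity
    orders the two families, and the order unit makes both nonempty, so the
    supremum of the first family is an admissible value. *)
Lemma riesz_extension_step (R : realType) (V : lmodType R) (K : set V)
    (G : set (V * R)) (y : V) :
  convex_cone K -> linear_graph G ->
  (forall v r, G (v, r) -> K v -> 0 <= r) ->
  (forall z, exists v r, G (v, r) /\ K (v - z)) ->
  exists G' : set (V * R),
    [/\ G `<=` G', linear_graph G', forall v r, G' (v, r) -> K v -> 0 <= r &
        exists c, G' (y, c)].
Proof.
move=> [K0 KD KZ] [G0 GL] Gpos Gunit.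
pose S := [set r : R | exists v, G (v, r) /\ K (y - v)].
have [v1 [r1 [G1 K1]]] := Gunit y.
have [v2 [r2 [G2 K2]]] := Gunit (- y).
have GN v r : G (v, r) -> G (- v, - r).
  by move=> Gv; have := GL (-1) _ _ _ _ Gv G0; rewrite scaleN1r mulN1r !addr0.
have GB v r w s : G (v, r) -> G (w, s) -> G (v - w, r - s).
  by move=> Gv /GN Gw; have := GL 1 _ _ _ _ Gv Gw; rewrite scale1r mul1r.
have S0 : S !=set0.
  by exists (- r2), (- v2); split; [exact: GN | rewrite opprK addrC -[y]opprK].
have Sub w s : G (w, s) -> K (w - y) -> ubound S s.
  move=> Gw Kw r [v [Gv Kv]]; rewrite -subr_ge0.
  apply: (Gpos (w - v)); first exact: GB.
  by rewrite -(subrK y w) -addrA; exact: KD.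
have hS : has_sup S by split=> //; exists r1; exact: Sub G1 K1.
exists [set p | exists a v r, G (v, r) /\ p = (v + a *: y, r + a * sup S)].
split.
- move=> [v r] Gv; exists 0, v, r; split=> //.
  by rewrite scale0r mul0r !addr0.
- split; first by exists 0, 0, 0; split=> //; rewrite scale0r mul0r !addr0.
  move=> a v r w s [b [v' [r' [Gv [-> ->]]]]] [c [w' [s' [Gw [-> ->]]]]].
  exists (a * b + c), (a *: v' + w'), (a * r' + s'); split; first exact: GL.
  by rewrite !scalerDr scalerDl scalerA addrACA; congr (_, _); ring.
- move=> w s [a [v [r [Gv [-> ->]]]]].
  have GZ b : G (b *: v, b * r).
    by have := GL b _ _ _ _ Gv G0; rewrite !addr0.
  have [a0|a0|->] := ltgtP a 0; last first.
  + by rewrite scale0r mul0r !addr0 => Kv; exact: Gpos Gv Kv.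
  + move=> Kw; have a1 : 0 <= a^-1 by rewrite invr_ge0 ltW.
    have : S (- a^-1 * r).
      exists (- a^-1 *: v); split; first exact: GZ.
      have := KZ _ _ a1 Kw.
      rewrite scalerDr scalerA mulVf ?gt_eqF// scale1r.
      by rewrite scaleNr opprK addrC.
    move/(ub_le_sup hS.2); rewrite mulNr -subr_ge0 opprK.
    by rewrite -(pmulr_rge0 _ a0) mulrDr mulrA divff ?gt_eqF// mul1r addrC.
  + move=> Kw; have a1 : 0 <= (- a)^-1 by rewrite invr_ge0 oppr_ge0 ltW.
    have : sup S <= (- a)^-1 * r.
      apply: ge_sup => //; apply: (Sub ((- a)^-1 *: v)); first exact: GZ.
      have := KZ _ _ a1 Kw.
      rewrite scalerDr scalerA -[X in X * a]opprK -invrN opprK mulNr.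
      by rewrite mulVf ?lt_eqF// scaleN1r.
    rewrite -subr_ge0 -(pmulr_rge0 _ (_ : 0 < - a)) ?oppr_gt0//.
    by rewrite mulrBr mulrA divff ?oppr_eq0 ?lt_eqF// mul1r mulNr opprK.
- by exists (sup S), 1, 0, 0; split=> //; rewrite scale1r mul1r !add0r.
Qed.

(** The M. Riesz extension theorem. In finite dimension it suffices to adjoin
    the vectors of a basis one after the other. *)
Lemma riesz_extension (R : realType) (V : vectType R) (K : set V)
    (G : set (V * R)) :
  convex_cone K -> linear_graph G ->
  (forall v r, G (v, r) -> K v -> 0 <= r) ->
  (forall z, exists v r, G (v, r) /\ K (v - z)) ->
  exists Phi : {linear V -> R^o},
    (forall v r, G (v, r) -> Phi v = r) /\ (forall v, K v -> 0 <= Phi v).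
Proof.
move=> Kcone Glin Gpos Gunit.
have [G' [sub Glin' Gpos' Gdef']] : exists G' : set (V * R),
    [/\ G `<=` G', linear_graph G', forall v r, G' (v, r) -> K v -> 0 <= r &
        forall y, y \in (vbasis {:V} : seq V) -> exists c, G' (y, c)].
  elim: (vbasis {:V} : seq V) => [|y s [G1 [sub1 lin1 pos1 def1]]].
    by exists G; split.
  have unit1 z : exists v r, G1 (v, r) /\ K (v - z).
    by have [v [r [/sub1 Gv Kv]]] := Gunit z; exists v, r.
  have [G2 [sub2 lin2 pos2 [c Gc]]] :=
    riesz_extension_step y Kcone lin1 pos1 unit1.
  exists G2; split=> // [p /sub1/sub2 //|z].
  rewrite inE => /orP[/eqP ->|/def1[b /sub2 Gb]]; first by exists c.
  by exists b.
have [G0 GL] := Glin'.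
have Gtot v : exists r, G' (v, r).
  rewrite (coord_vbasis (memvf v)).
  elim/big_ind: _ => [|x y [r Gx] [s Gy]|i _]; first by exists 0.
  - by exists (r + s); have := GL 1 _ _ _ _ Gx Gy; rewrite scale1r mul1r.
  - have [|c Gc] := Gdef' (vbasis {:V})`_i.
      by rewrite mem_nth ?size_tuple.
    exists (coord (vbasis fullv) i v * c).
    by have := GL (coord (vbasis fullv) i v) _ _ _ _ Gc G0; rewrite !addr0.
have G00 r : G' (0, r) -> 0 <= r by move=> /Gpos'; apply; case: Kcone.
have Guniq v r s : G' (v, r) -> G' (v, s) -> r = s.
  move=> Gr Gs; apply/eqP; rewrite eq_le.
  rewrite -[X in X && _]subr_ge0 -[X in _ && X]subr_ge0.
  have D a b : G' (v, a) -> G' (v, b) -> 0 <= b - a.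
    move=> Ga Gb; apply: G00; have := GL (-1) _ _ _ _ Ga Gb.
    by rewrite scaleN1r addNr mulN1r addrC.
  by rewrite (D _ _ Gr Gs) (D _ _ Gs Gr).
pose f v : R^o := xget 0 [set r | G' (v, r)].
have fP v : G' (v, f v).
  by rewrite /f; case: xgetP => [//|]; have [r Gr] := Gtot v => /(_ r).
have flin : linear f.
  by move=> a v w; apply: (Guniq (a *: v + w)) => //; exact: GL.
pose Phi := GRing.isLinear.Build _ _ _ _ f flin.
pose PhiL : {linear V -> R^o} := HB.pack f Phi.
exists PhiL; split=> [v r /sub Gv|v Kv]; first exact: (Guniq v).
exact: (Gpos' v).
Qed.

(** * Positive semidefinite matrices *)

Lemma symmetricmxP (R : realType) n (A : 'M[R]_n) :
  reflect (A^T = A) (A \is symmetricmx).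
Proof.
apply: (iffP eqP); first by rewrite scale1r map_mx_id// => /esym.
by rewrite scale1r map_mx_id// => /esym.
Qed.

Lemma quad_block (R : realType) n (a y : R) (b : 'rV[R]_n) (D : 'M[R]_n)
    (x : 'cV[R]_n) :
  ((col_mx y%:M x)^T *m block_mx a%:M b b^T D
     *m (col_mx y%:M x : 'cV[R]_(1 + n))) 0 0
  = a * y ^+ 2 + 2 * (y * (b *m x) 0 0) + (x^T *m D *m x) 0 0.
Proof.
rewrite tr_col_mx tr_scalar_mx mul_row_block mul_row_col !mulmxDl.
rewrite -trmx_mul !mul_mx_scalar !mul_scalar_mx -!scalemxAl.
have DE (A B : 'M[R]_1) : (A + B) 0 0 = A 0 0 + B 0 0 by rewrite mxE.
have ZE c (A : 'M[R]_1) : (c *: A) 0 0 = c * A 0 0 by rewrite mxE.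
rewrite !DE !ZE [_^T 0 0]mxE [_%:M 0 0]mxE eqxx mulr1n; ring.
Qed.

(** Completing the square in the first variable leaves the Schur complement
    [D - a^-1 b^T b], which is again positive semidefinite, and induction
    applies. If the corner [a] vanishes then so does [b]; with [a^-1 = 0] the
    same formulas cover that case. *)
Lemma psdmx_gram (R : realType) n (A : 'M[R]_n) :
  psdmx A -> exists P : 'M[R]_n, A = P^T *m P.
Proof.
elim: n A => [|n IH].
  by move=> A _; exists 0; rewrite [A]flatmx0 [RHS]flatmx0.
change (forall A : 'M[R]_(1 + n), psdmx A ->
  exists P : 'M[R]_(1 + n), A = P^T *m P) => A [/symmetricmxP symA posA].
rewrite -[A]submxK in symA posA *.
move: symA posA.
set b := ursubmx _; set D := drsubmx _; rewrite [ulsubmx _]mx11_scalar.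
set a := _ 0 0; set c := dlsubmx _.
rewrite tr_block_mx tr_scalar_mx.
move/eq_block_mx => [_ _ cE DE]; rewrite -cE => posA.
have quad_ge0 y (x : 'cV_n) :
    0 <= a * y ^+ 2 + 2 * (y * (b *m x) 0 0) + (x^T *m D *m x) 0 0.
  by rewrite -quad_block; exact: posA.
have a_ge0 : 0 <= a.
  by have := quad_ge0 1 0; rewrite !mulmx0 mxE expr1n; lra.
have b0 : a = 0 -> b = 0.
  move=> a0; apply/rowP => j; rewrite [RHS]mxE; apply/eqP/negP => /negP bj.
  (* With a = 0 the form is affine in y; this y makes its value -1. *)
  pose x : 'cV[R]_n := delta_mx j 0; pose e := (x^T *m D *m x) 0 0.
  have := quad_ge0 (- (e + 1) / (2 * b 0 j)) x.
  rewrite a0 mul0r add0r -colE [col _ _ _ _]mxE -/e.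
  have -> : 2 * (- (e + 1) / (2 * b 0 j) * b 0 j) + e = -1 by field.
  by rewrite lerNr oppr0 ler10.
pose D' := D - a^-1 *: (b^T *m b).
have [Q QE] : exists Q : 'M[R]_n, D' = Q^T *m Q.
  apply: IH; split.
    by apply/symmetricmxP; rewrite /D' linearB linearZ /= trmx_mul trmxK DE.
  move=> x; pose t := (b *m x) 0 0; pose e := (x^T *m D *m x) 0 0.
  have -> : (x^T *m D' *m x) 0 0 = e - a^-1 * (t * t).
    rewrite mulmxBr mulmxBl -scalemxAr -scalemxAl mulmxA -trmx_mul.
    rewrite -[_ *m b *m x]mulmxA.
    rewrite [(b *m x)^T]mx11_scalar mul_scalar_mx.
    rewrite [LHS]mxE [X in _ + X]mxE [X in - X]mxE [X in _ * X]mxE.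
    by rewrite [_^T 0 0]mxE.
  (* y = - t / a minimises the form over the first variable when a > 0. *)
  have := quad_ge0 (- a^-1 * t) x; rewrite -/t -/e.
  have [a0|a0] := eqVneq a 0; first by rewrite a0 invr0; lra.
  suff -> : a * (- a^-1 * t) ^+ 2 + 2 * (- a^-1 * t * t) + e
         = e - a^-1 * (t * t) by [].
  by field.
exists (block_mx (Num.sqrt a)%:M ((Num.sqrt a)^-1 *: b) 0 Q).
rewrite tr_block_mx mulmx_block trmx0 tr_scalar_mx !mul0mx !mulmx0 !addr0.
rewrite -scalar_mxM -expr2 sqr_sqrtr// -QE /D' !linearZ /=.
rewrite mul_scalar_mx mul_mx_scalar scalerA -scalemxAl !scalerA.
rewrite -invfM -expr2 sqr_sqrtr// scalerN addrCA subrr addr0.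
have [a0|a0] := eqVneq a 0; first by rewrite b0 ?a0 // trmx0 !scaler0.
by rewrite mulrC divff ?scale1r// gt_eqF// sqrtr_gt0 lt_def a0.
Qed.

(** With [Z = P^T P], the trace of [Z A] is the sum of the values of the form
    of [A] at the rows of [P]. *)
Lemma mxtrace_psdmx_ge0 (R : realType) n (Z A : 'M[R]_n) :
  psdmx Z -> psdmx A -> 0 <= \tr (Z *m A).
Proof.
move=> /psdmx_gram[P ->] [_ posA]; rewrite -mulmxA mxtrace_mulC.
apply: sumr_ge0 => i _; have := posA (row i P)^T.
rewrite trmxK => /le_trans; apply.
suff -> : (P *m A *m P^T) i i = (row i P *m A *m (row i P)^T) 0 0 by [].
by rewrite -row_mul tr_row; rewrite !mxE; apply: eq_bigr => k _; rewrite !mxE.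
Qed.

(** * The Taylor remainder of a polynomial with SOS second derivative *)

(** The integral of [(1 - s) s^i] over [0, 1]: these are the weights in
    [f(1) - f(0) - f'(0)], the integral of [(1 - s) f''(s)] over [0, 1]. *)
Definition remainder_weight (R : realType) (i : nat) : R := (i.+2 * i.+1)%:R^-1.

Lemma taylor_remainder (R : realType) (A : comAlgType R) (f : {poly A}) n :
  (size f <= n.+2)%N ->
  f.[1] - f.[0] - f^`().[0] =
  \sum_(i < n) remainder_weight R i *: (f^`()^`())`_i.
Proof.
move=> sf; rewrite (horner_coef_wide _ sf) !horner_coef0 coef_deriv.
rewrite 2!big_ord_recl /= !expr1n !mulr1 mulr1n.
have -> (a b s : A) : a + (b + s) - a - b = s.
  by rewrite -[a + _ - a]addrC !addrA addNr add0r -addrA addrC -addrA addNr addr0.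
apply: eq_bigr => i _; rewrite expr1n mulr1 !coef_deriv -mulrnA.
rewrite -scaler_nat scalerA /remainder_weight mulVf ?scale1r//.
Qed.

(** On a square the remainder is a quadratic form in the coefficients of [q],
    whose matrix has real entries that depend on neither [q] nor the algebra. *)
Lemma remainder_square (R : realType) (A : comAlgType R) (q : {poly A}) k n :
  (size q <= k)%N -> (k + k <= n)%N ->
  \sum_(i < n) remainder_weight R i *: (q ^+ 2)`_i =
  \sum_(a < k) \sum_(b < k) remainder_weight R (a + b) *: (q`_a * q`_b).
Proof.
move=> sq kn.
have qE : q = \sum_(a < k) q`_a *: 'X^a.
  rewrite -poly_def; apply/polyP => i; rewrite coef_poly; case: ltnP => // ki.
  by rewrite nth_default// (leq_trans sq).
have coef_sq i :
    (q ^+ 2)`_i = \sum_(a < k) \sum_(b < k) (q`_a * q`_b) *+ (i == a + b)%N.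
  rewrite expr2 {1 2}qE mulr_suml coef_sum; apply: eq_bigr => a _.
  rewrite mulr_sumr coef_sum; apply: eq_bigr => b _.
  by rewrite -scalerAl -scalerAr -exprD scalerA coefZ coefXn mulr_natr.
under eq_bigr => i _.
  rewrite coef_sq scaler_sumr; under eq_bigr => a _ do rewrite scaler_sumr.
over.
rewrite exchange_big; apply: eq_bigr => a _.
rewrite exchange_big; apply: eq_bigr => b _ /=.
have abn : (a + b < n)%N by rewrite (leq_trans _ kn)// -addSn leq_add// ltnW.
rewrite (bigD1 (Ordinal abn)) //= eqxx mulr1n big1 ?addr0// => i.
by rewrite -val_eqE /= => /negPf ->; rewrite mulr0n scaler0.
Qed.

Lemma remainder_ge0 (R : realType) (f : {poly R}) :
  (forall x, 0 <= f^`()^`().[x]) -> 0 <= f.[1] - f.[0] - f^`().[0].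
Proof.
move=> f2.
have [x x01 ->] := polyrcf.poly_mvt f (@ltr01 R).
have x0 : 0 < x by move: x01; rewrite in_itv/= => /andP[].
have [y _] := polyrcf.poly_mvt f^`() x0.
by rewrite !subr0 mulr1 => ->; rewrite mulr_ge0// ltW.
Qed.

(** Over the reals the quadratic form evaluates the Taylor remainder of a
    double primitive of a square, that is, of a convex function. *)
Lemma remainder_gram_psdmx (R : realType) n :
  psdmx (\matrix_(a < n, b < n) remainder_weight R (a + b)).
Proof.
split; first by apply/symmetricmxP/matrixP => a b; rewrite !mxE addnC.
move=> x.
pose q : {poly R^o} :=
  \poly_(a < n) (if insub a is Some i then x i 0 else 0).
have qE (a : 'I_n) : q`_a = x a 0 by rewrite coef_poly ltn_ord valK.
have -> : (x^T *m (\matrix_(a, b) remainder_weight R (a + b)) *m x) 0 0 =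
    \sum_(a < n) \sum_(b < n) remainder_weight R (a + b) *: (q`_a * q`_b).
  rewrite mxE exchange_big /=; apply: eq_bigr => b _.
  rewrite mxE mulr_suml; apply: eq_bigr => a _; rewrite !mxE !qE.
  by rewrite /GRing.scale/=; ring.
rewrite -(@remainder_square _ _ q n (n + n)%N) ?size_poly//.
pose f : {poly R^o} := \poly_(i < (n + n).+2)
  (if i is j.+2 then remainder_weight R j * (q ^+ 2)`_j else 0).
have sq : (size (q ^+ 2) <= n + n)%N.
  rewrite expr2 (leq_trans (size_mul_leq _ _))//.
  by rewrite (leq_trans (leq_pred _))// leq_add// size_poly.
have fE : f^`()^`() = q ^+ 2.
  apply/polyP => i; rewrite !coef_deriv coef_poly !ltnS.
  case: ltnP => [_|/(leq_trans sq) /(nth_default 0) ->]; last first.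
    by rewrite !mul0rn.
  rewrite -mulrnA -mulr_natr /remainder_weight mulrAC mulVf ?mul1r//.
rewrite -fE -(@taylor_remainder _ R^o f) ?size_poly//.
by apply: remainder_ge0 => y; rewrite fE hornerE /= sqr_ge0.
Qed.

(** Factoring the real Gram matrix as [P^T P] writes the remainder of a square
    as a sum of squares of real combinations of coefficients. This makes sense
    in any commutative real algebra, in particular in a polynomial ring. *)
Lemma remainder_sos (R : realType) (A : comAlgType R) (f : {poly A})
    (s : seq {poly A}) :
  f^`()^`() = \sum_(q <- s) q ^+ 2 ->
  exists t : seq A, f.[1] - f.[0] - f^`().[0] = \sum_(c <- t) c ^+ 2.
Proof.
move=> fE; pose k := \max_(q <- s) size q.
have sk q : q \in s -> (size q <= k)%N by move=> qs; exact: leq_bigmax_seq.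
(* Long enough both for f'' and for the products of two coefficients. *)
pose n := (maxn (k + k) (size f)).
have [P PE] := psdmx_gram (remainder_gram_psdmx R k).
have weightE (a b : 'I_k) :
    remainder_weight R (a + b) = \sum_(i < k) P i a * P i b.
  have /matrixP/(_ a b) := PE; rewrite !mxE => ->.
  by apply: eq_bigr => i _; rewrite mxE.
exists [seq \sum_(a < k) P i a *: (q`_a)
  | q : {poly A} <- s, i : 'I_k <- enum 'I_k].
rewrite (@taylor_remainder _ _ _ n); last first.
  by rewrite (leq_trans (leq_maxr (k + k) _))// ltnW// ltnW.
rewrite fE big_allpairs_dep /=.
under eq_bigr do rewrite coef_sum scaler_sumr.
rewrite exchange_big big_seq [RHS]big_seq /=; apply: eq_bigr => q qs.
rewrite (@remainder_square _ _ q k) ?sk ?leq_maxl//.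
rewrite big_enum /= [RHS](eq_bigr (fun i : 'I_k => \sum_(a < k) \sum_(b < k)
    (P i a * P i b) *: (q`_a * q`_b))); last first.
  move=> i _; rewrite expr2 mulr_suml; apply: eq_bigr => a _.
  rewrite mulr_sumr; apply: eq_bigr => b _.
  by rewrite -scalerAl -scalerAr scalerA.
rewrite [RHS]exchange_big; apply: eq_bigr => a _ /=.
rewrite [RHS]exchange_big; apply: eq_bigr => b _ /=.
by rewrite weightE scaler_suml.
Qed.

(** * SOS-convex polynomials and their tangents *)

(** Statements about evaluation and derivation hold for all polynomials as
    soon as they are compatible with the ring operations. *)
Lemma mpoly_ring_ind (R : realType) m (P : {mpoly R[m]} -> Prop) :
  (forall c, P (mpoly.mpolyC m c)) ->
  (forall i, P (mpoly.mpolyX R (mpoly.mnm1 i))) ->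
  (forall p q, P p -> P q -> P (p + q)) ->
  (forall p q, P p -> P q -> P (p * q)) -> forall p, P p.
Proof.
move=> PC PX PD PM p; elim/mpoly.mpolyind: p => [|c e p _ _ Pp].
  by rewrite -mpoly.mpolyC0; exact: PC.
apply: (PD) => //; rewrite -mpoly.mul_mpolyC; apply: (PM); first exact: PC.
rewrite mpoly.mpolyXE_id; elim/big_ind: _ => [||i _].
- by rewrite -mpoly.mpolyC1; exact: PC.
- exact: PM.
- elim: (e i) => [|k IH]; first by rewrite expr0 -mpoly.mpolyC1; exact: PC.
  by rewrite exprS; exact: PM.
Qed.

Lemma meval_continuous (R : realType) m (p : {mpoly R[m]}) :
  continuous (fun v : 'rV[R]_m => mpoly.meval (v 0) p).
Proof.
elim/mpoly_ring_ind: p => [c|i|p q cp cq|p q cp cq] v.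
- rewrite (_ : (fun _ => _) = cst c); first exact: cst_continuous.
  by apply/funext => w; rewrite mpoly.mevalC.
- rewrite (_ : (fun _ => _) = (fun w : 'rV[R]_m => w 0 i)).
    exact: coord_continuous.
  by apply/funext => w; rewrite mpoly.mevalXU.
- under eq_fun do rewrite mpoly.mevalD.
  by apply: continuousD; [exact: cp|exact: cq].
- under eq_fun do rewrite mpoly.mevalM.
  by apply: continuousM; [exact: cp|exact: cq].
Qed.

Section Ray.
Variables (R : realType) (m : nat) (A : comNzRingType) (f : {rmorphism R -> A}).
Variables (a d : 'I_m -> A).

(** The restriction [s |-> h(a + s d)] as a polynomial in [s]. The coefficients
    of [a] and [d] live in an algebra [A] over the reals, so that the end of the
    ray can be the vector of the indeterminates. *)
Definition along_ray (h : {mpoly R[m]}) : {poly A} :=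
  mpoly.mmap (polyC \o f) (fun i => (a i)%:P + d i *: 'X) h.

Lemma along_rayD : {morph along_ray : p q / p + q}.
Proof. exact: mpoly.mmapD. Qed.

Lemma along_rayM : {morph along_ray : p q / p * q}.
Proof. by move=> p q; rewrite /along_ray rmorphM. Qed.

Lemma along_rayC c : along_ray (mpoly.mpolyC m c) = (f c)%:P.
Proof. exact: mpoly.mmapC. Qed.

Lemma along_ray_eq0 : along_ray 0 = 0.
Proof. by rewrite -mpoly.mpolyC0 along_rayC rmorph0. Qed.

Lemma along_rayX i : along_ray (mpoly.mpolyX R (mpoly.mnm1 i)) =
  (a i)%:P + d i *: 'X.
Proof. by rewrite /along_ray mpoly.mmapX mpoly.mmap1U. Qed.

Lemma horner_along_ray t h :
  (along_ray h).[t] = mpoly.mmap f (fun i => a i + d i * t) h.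
Proof.
elim/mpoly_ring_ind: h => [c|i|p q IHp IHq|p q IHp IHq].
- by rewrite along_rayC hornerC mpoly.mmapC.
- rewrite along_rayX hornerD hornerC hornerZ hornerX.
  by rewrite mpoly.mmapX mpoly.mmap1U.
- by rewrite along_rayD hornerD IHp IHq mpoly.mmapD.
- by rewrite along_rayM hornerM IHp IHq rmorphM.
Qed.

Lemma deriv_along_ray h :
  (along_ray h)^`() = \sum_(i < m) along_ray (mpoly.mderiv i h) * (d i)%:P.
Proof.
elim/mpoly_ring_ind: h => [c|i|p q IHp IHq|p q IHp IHq].
- rewrite along_rayC derivC big1// => i _.
  by rewrite mpoly.mderivC along_ray_eq0 mul0r.
- rewrite along_rayX derivD derivC add0r derivZ derivX (bigD1 i)//= big1.
    rewrite mpoly.mderivX mpoly.mnm1E eqxx scale1r.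
    rewrite -{1}(mpoly.add0m (mpoly.mnm1 i)) mpoly.addmK.
    rewrite mpoly.mpolyX0 -mpoly.mpolyC1 along_rayC rmorph1.
    by rewrite mul1r addr0 alg_polyC.
  move=> j ji; rewrite mpoly.mderivX mpoly.mnm1E eq_sym (negPf ji) scale0r.
  by rewrite along_ray_eq0 mul0r.
- rewrite along_rayD derivD IHp IHq -big_split/=; apply: eq_bigr => i _.
  by rewrite mpoly.mderivD along_rayD mulrDl.
- rewrite along_rayM derivM IHp IHq mulr_suml mulr_sumr -big_split/=.
  apply: eq_bigr => i _.
  by rewrite mpoly.mderivM along_rayD !along_rayM; ring.
Qed.

(** The second derivative along the ray is [d^T H d] with [H] the Hessian, and
    [H = P^T P] turns it into the squared norm of [P d]. *)
Lemma deriv2_along_ray (g : {mpoly R[m]}) : sos_convex g ->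
  exists s : seq {poly A}, (along_ray g)^`()^`() = \sum_(q <- s) q ^+ 2.
Proof.
move=> [k [P HP]].
exists [seq \sum_(i < m) along_ray (P j i) * (d i)%:P | j <- enum 'I_k].
rewrite big_map big_enum /= deriv_along_ray raddf_sum /=.
rewrite [RHS](eq_bigr (fun j : 'I_k => \sum_(i < m) \sum_(l < m)
  along_ray (P j i * P j l) * ((d i)%:P * (d l)%:P))); last first.
  move=> j _; rewrite expr2 mulr_suml; apply: eq_bigr => i _.
  by rewrite mulr_sumr; apply: eq_bigr => l _; rewrite along_rayM; ring.
rewrite [RHS]exchange_big; apply: eq_bigr => i _ /=.
rewrite derivM derivC mulr0 addr0 deriv_along_ray mulr_suml.
rewrite [RHS]exchange_big; apply: eq_bigr => l _ /=.
have /matrixP/(_ i l) := HP; rewrite !mxE => ->.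
rewrite -mulrA -mulr_suml; congr (_ * _); last exact: mulrC.
rewrite (big_morph along_ray along_rayD along_ray_eq0).
by apply: eq_bigr => j _; rewrite mxE.
Qed.

End Ray.

(** The Taylor remainder at [u] as a polynomial identity: the ray runs from [u]
    at time 0 to the generic point [X] at time 1. *)
Lemma sos_convex_tangent (R : realType) m (g : {mpoly R[m]}) (u : 'rV[R]_m) :
  sos_convex g ->
  sos (g - mpoly.mpolyC m (mpoly.meval (u 0) g)
       - \sum_(i < m) mpoly.meval (u 0) (mpoly.mderiv i g) *:
           (mpoly.mpolyX R (mpoly.mnm1 i) - mpoly.mpolyC m (u 0 i))).
Proof.
pose C : {rmorphism R -> {mpoly R[m]}} := @mpoly.mpolyC m R.
pose dir (i : 'I_m) : {mpoly R[m]} :=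
  mpoly.mpolyX R (mpoly.mnm1 i) - C (u 0 i).
pose ray := along_ray C (fun i => C (u 0 i)) dir.
move=> /(deriv2_along_ray C (fun i => C (u 0 i)) dir)[s /remainder_sos[t tE]].
exists t; rewrite -tE.
have ray0 h : (ray h).[0] = C (mpoly.meval (u 0) h).
  rewrite /ray horner_along_ray.
  elim/mpoly_ring_ind: h => [c|i|p q IHp IHq|p q IHp IHq].
  - by rewrite mpoly.mmapC mpoly.mevalC.
  - by rewrite mpoly.mmapX mpoly.mmap1U mpoly.mevalXU mulr0 addr0.
  - by rewrite mpoly.mmapD mpoly.mevalD IHp IHq rmorphD.
  - by rewrite rmorphM mpoly.mevalM /= IHp IHq rmorphM.
have ray1 h : (ray h).[1] = h.
  rewrite /ray horner_along_ray.
  elim/mpoly_ring_ind: h => [c|i|p q IHp IHq|p q IHp IHq].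
  - by rewrite mpoly.mmapC.
  - by rewrite mpoly.mmapX mpoly.mmap1U mulr1 addrC subrK.
  - by rewrite mpoly.mmapD IHp IHq.
  - by rewrite rmorphM /= IHp IHq.
rewrite -/(ray g) ray0 ray1 deriv_along_ray horner_sum; congr (_ - _).
apply: eq_bigr => i _.
by rewrite hornerM hornerC -/(ray _) ray0 mpoly.mul_mpolyC.
Qed.

Lemma sos_meval_ge0 (R : realType) m (p : {mpoly R[m]}) (v : 'I_m -> R) :
  sos p -> 0 <= mpoly.meval v p.
Proof.
move=> [s ->]; rewrite raddf_sum /=; apply: sumr_ge0 => q _.
by rewrite rmorphXn /= sqr_ge0.
Qed.

Lemma sos_convex_gradient (R : realType) m (g : {mpoly R[m]}) (u v : 'rV[R]_m) :
  sos_convex g ->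
  mpoly.meval (u 0) g
    + \sum_(i < m) mpoly.meval (u 0) (mpoly.mderiv i g) * (v 0 i - u 0 i)
  <= mpoly.meval (v 0) g.
Proof.
move=> /(sos_convex_tangent u)/(@sos_meval_ge0 _ _ _ (v 0)).
rewrite !mpoly.mevalB mpoly.mevalC.
rewrite [X in _ - X]raddf_sum /= subr_ge0 lerBrDl.
congr (_ + _ <= _); apply: eq_bigr => i _.
by rewrite mpoly.mevalZ mpoly.mevalB mpoly.mevalXU mpoly.mevalC.
Qed.

(** * Consequences of compactness *)

Lemma compact_min_max (R : realType) m L (A : set 'rV[R]_m)
    (f : 'I_L -> 'rV[R]_m -> R) :
  (0 < L)%N -> A !=set0 -> compact A -> (forall l, continuous (f l)) ->
  exists u c, [/\ A u, forall l, f l u <= c &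
                  forall v, A v -> exists l, c <= f l v].
Proof.
move=> L0 A0 cA cf; pose l0 := Ordinal L0.
pose F v := \big[Num.max/f l0 v]_(l < L) f l v.
have cF : continuous F.
  move=> v; rewrite /F.
elim: (index_enum _) => [|l s IH].
    by under eq_fun do rewrite big_nil; exact: cf.
  under eq_fun do rewrite big_cons.
  by apply: (@continuous_max R _ (f l)); [exact: cf|exact: IH].
have [u uA umin] := EVT_min_rV A0 cA (continuous_subspaceT cF).
exists u, (F u); split=> [|l|v Av]; first by rewrite inE in uA.
  exact: le_bigmax.
have : F u <= F v by apply: umin; rewrite inE.
by case/bigmax_geP => [?|[l _ ?]]; [exists l0|exists l].
Qed.

(** A quadratic form is a polynomial function, hence continuous. *)
Lemma quad_continuous (R : realType) n (S : 'M[R]_n) :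
  continuous (fun w : 'rV[R]_n => (w *m S *m w^T) 0 0).
Proof.
pose p : {mpoly R[n]} := \sum_(j < n) \sum_(i < n)
  S i j *: (mpoly.mpolyX R (mpoly.mnm1 i) * mpoly.mpolyX R (mpoly.mnm1 j)).
rewrite (_ : (fun _ => _) = fun w : 'rV[R]_n => mpoly.meval (w 0) p).
  exact: meval_continuous.
apply/funext => w; rewrite [X in _ = X]raddf_sum mxE /=; apply: eq_bigr => j _.
rewrite [X in _ = X]raddf_sum mxE mulr_suml /=; apply: eq_bigr => i _.
rewrite mpoly.mevalZ mpoly.mevalM !mpoly.mevalXU !mxE; ring.
Qed.

Lemma compact_unit_sphere (R : realType) n : compact [set w : 'rV[R]_n | `|w| = 1].
Proof.
apply: bounded_closed_compact.
  by exists 1; split; [exact: num_real|move=> M M1 w /= ->; exact: ltW].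
apply: (@preimage_closed _ _ (fun w : 'rV[R]_n => `|w|) [set 1]).
  by move=> w _; exact: norm_continuous.
exact: closed_eq.
Qed.

(** On the unit sphere the form of [A] has a positive minimum and the form of
    [S] a maximum; homogeneity carries the comparison to all vectors. The sphere
    is empty in dimension 0. *)
Lemma pdmx_order_unit (R : realType) n (A S : 'M[R]_n) : pdmx A ->
  exists2 s, 0 <= s &
    forall x : 'cV[R]_n, (x^T *m S *m x) 0 0 <= s * (x^T *m A *m x) 0 0.
Proof.
move=> [_ posA].
have [Ssphere|/nonemptyPn sphere0] := pselect ([set w : 'rV[R]_n | `|w| = 1] !=set0).
  have [a a1 amin] := EVT_min_rV Ssphere (@compact_unit_sphere _ _)
    (continuous_subspaceT (@quad_continuous _ _ A)).
  have [b b1 bmax] := EVT_max_rV Ssphere (@compact_unit_sphere _ _)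
    (continuous_subspaceT (@quad_continuous _ _ S)).
  rewrite !inE /= in a1 b1.
  pose ma := (a *m A *m a^T) 0 0; pose mb := (b *m S *m b^T) 0 0.
  have ma0 : 0 < ma.
    rewrite /ma -{1}[a]trmxK; apply: posA; rewrite -trmx0 (inj_eq trmx_inj).
    by rewrite -normr_eq0 a1 oner_eq0.
  exists (`|mb| / ma) => [|x]; first by rewrite divr_ge0// ltW.
  have [->|x0] := eqVneq x 0; first by rewrite !mulmx0 !mxE mulr0.
  pose k := `|x^T|; pose w := k^-1 *: x^T.
  have k0 : 0 < k by rewrite normr_gt0 -trmx0 (inj_eq trmx_inj).
  have w1 : w \in [set w : 'rV[R]_n | `|w| = 1].
    by rewrite inE /= normrZ normfV normr_id mulVf// gt_eqF.
  have quadE (T : 'M[R]_n) : (x^T *m T *m x) 0 0 = k ^+ 2 * (w *m T *m w^T) 0 0.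
    rewrite /w linearZ /= trmxK -!scalemxAl -scalemxAr scalerA [in RHS]mxE.
    by rewrite mulrA -expr2 -exprMn divff ?gt_eqF// expr1n mul1r.
  rewrite !quadE mulrCA ler_pM2l ?exprn_gt0//.
  apply: (le_trans (bmax _ w1)); apply: (le_trans (ler_norm _)).
  rewrite -/mb mulrAC ler_pdivlMr// ler_wpM2l//; exact: amin.
exists 0 => // x; suff -> : x = 0 by rewrite !mulmx0 !mxE mulr0.
apply/eqP/negP => /negP x0.
have k0 : `|x^T| != 0 by rewrite normr_eq0 -trmx0 (inj_eq trmx_inj).
have : [set w : 'rV[R]_n | `|w| = 1] (`|x^T|^-1 *: x^T).
  by rewrite /= normrZ normfV normr_id mulVf.
by rewrite sphere0.
Qed.

(** * Multipliers at a minimax point *)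

Section KKT.
Variables (R : realType) (m L nu N : nat).
Variables (F0 : 'M[R]_nu) (F : 'I_m -> 'M[R]_nu) (M : 'I_N -> 'M[R]_nu).
Hypotheses (symF0 : F0 \is symmetricmx) (symF : forall i, F i \is symmetricmx)
  (symM : forall t, M t \is symmetricmx).
Variables (g : 'I_L -> {mpoly R[m]}) (u : 'rV[R]_m) (gam : R).
Hypothesis convex_g : forall l, sos_convex (g l).
Hypothesis Omega_u : Omega F0 F M u.
Hypothesis g_u : forall l, mpoly.meval (u 0) (g l) <= gam.
Hypothesis u_min :
  forall v, Omega F0 F M v -> exists l, gam <= mpoly.meval (v 0) (g l).

Let lin (x : 'rV[R]_m) (xi : 'rV[R]_N) : 'M[R]_nu :=
  \sum_(i < m) x 0 i *: F i + \sum_(t < N) xi 0 t *: M t.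

Let slope (w : 'rV[R]_m) (l : 'I_L) (x : 'rV[R]_m) : R :=
  \sum_(i < m) mpoly.meval (w 0) (mpoly.mderiv i (g l)) * x 0 i.

Let lmiE v xi : lmi F0 F M v xi = F0 + lin v xi.
Proof. by rewrite /lmi addrA. Qed.

Let lin_linear a x xi y eta :
  lin (a *: x + y) (a *: xi + eta) = a *: lin x xi + lin y eta.
Proof.
rewrite /lin scalerDr addrACA !scaler_sumr -!big_split /=.
by congr (_ + _); apply: eq_bigr => i _; rewrite !mxE scalerDl scalerA.
Qed.

Let linZ a x xi : lin (a *: x) (a *: xi) = a *: lin x xi.
Proof.
have lin0 : lin 0 0 = 0.
  by rewrite /lin !big1 ?addr0// => i _; rewrite mxE scale0r.
by rewrite -[a *: x]addr0 -[a *: xi]addr0 lin_linear lin0 addr0.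
Qed.

Let slope_linear w l a x y :
  slope w l (a *: x + y) = a * slope w l x + slope w l y.
Proof.
rewrite /slope mulr_sumr -big_split /=.
by apply: eq_bigr => i _; rewrite !mxE; ring.
Qed.

Let lmi_sym v xi : lmi F0 F M v xi \is symmetricmx.
Proof.
apply/symmetricmxP; rewrite /lmi !linearD !linear_sum /=.
rewrite (symmetricmxP _ symF0); congr (_ + _ + _); apply: eq_bigr => i _;
  by rewrite linearZ /= (symmetricmxP _ _).
Qed.

Let quadD (x : 'cV[R]_nu) a (S T : 'M[R]_nu) :
  (x^T *m (a *: S + T) *m x) 0 0 =
  a * (x^T *m S *m x) 0 0 + (x^T *m T *m x) 0 0.
Proof. by rewrite mulmxDr mulmxDl -scalemxAr -scalemxAl !mxE. Qed.

(** First-order optimality of [u], in homogeneous form: [t] and [x] encode the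
    displacement towards [u + x / t], the matrix inequality says that the target
    is feasible (for [t = 0], that [x] is a recession direction), and [tau]
    bounds the linearised objectives. Were [tau] negative, a short step
    [u + s x] would stay feasible and, by the gradient inequality based at the
    new point, bring every [g l] below the optimal value [gam]. *)
Lemma no_descent_direction t x xi tau :
  0 <= t ->
  (forall y : 'cV[R]_nu,
     0 <= (y^T *m (t *: (F0 + lin u 0) + lin x xi) *m y) 0 0) ->
  (forall l, t * (mpoly.meval (u 0) (g l) - gam) + slope u l x <= tau) ->
  0 <= tau.
Proof.
move=> t0 posS slopeS; rewrite leNgt; apply/negP => tau0.
have [xiu [_ posu]] := Omega_u.
have slope_cont l : continuous (fun w => slope w l x).
  rewrite (_ : (fun _ => _) = fun w : 'rV[R]_m =>
      mpoly.meval (w 0) (\sum_(i < m) x 0 i *: mpoly.mderiv i (g l))).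
    exact: meval_continuous.
  apply/funext => w; rewrite [RHS]raddf_sum /=; apply: eq_bigr => i _.
  by rewrite mpoly.mevalZ mulrC.
(* The gradient inequality is used at the new point u + s x, so the slopes
   there must still be close to those at u. *)
have nearu : \forall w \near u, forall l, slope w l x < slope u l x - tau.
  apply: (@filter_forall _ _
    (fun l w => slope w l x < slope u l x - tau) (nbhs u)) => l.
  by apply: (cvgr_lt (slope u l x)); [exact: slope_cont|rewrite ltrDl oppr_gt0].
have ray_cont : (fun s : R => u + s *: x) @ 0 --> u.
  have /(_ 0) : continuous (fun s : R => u + s *: x).
    move=> s; apply: (@continuousD R 'rV[R]_m R (fun=> u) (fun s => s *: x)).
      exact: cst_continuous.
    exact: scalel_continuous.
  by rewrite /continuous_at /= scale0r addr0.
have near0 : \forall s \near (0 : R)^'+,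
    forall l, slope (u + s *: x) l x < slope u l x - tau.
  have near0 : \forall s \near (0 : R), forall l,
      slope (u + s *: x) l x < slope u l x - tau := ray_cont _ nearu.
  by apply: filterS near0 => s sP _; exact: sP.
have [s [s0 st sE]] : exists s : R, [/\ 0 < s, s * t < 1 &
    forall l, slope (u + s *: x) l x < slope u l x - tau].
  have st1 : 0 < (1 + t)^-1 by rewrite invr_gt0 ltr_pwDl.
  have : \forall s \near (0 : R)^'+, [/\ 0 < s, s * t < 1 &
    forall l, slope (u + s *: x) l x < slope u l x - tau].
    near=> s; split; last by near: s.
      by near: s; exact: nbhs_right_gt.
    have : s < (1 + t)^-1 by near: s; exact: nbhs_right_lt.
    have s0 : 0 < s by near: s; exact: nbhs_right_gt.
    rewrite -div1r ltr_pdivlMr ?ltr_pwDl// mulrDr mulr1.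
    by apply: lt_trans; rewrite ltrDr.
  by move/filter_ex.
have : Omega F0 F M (u + s *: x).
  exists ((1 - s * t) *: xiu + s *: xi); split; first exact: lmi_sym.
  move=> y.
  have -> : lmi F0 F M (u + s *: x) ((1 - s * t) *: xiu + s *: xi) =
     (1 - s * t) *: lmi F0 F M u xiu + s *: (t *: (F0 + lin u 0) + lin x xi).
    (* The new matrix mixes the one at u with the given direction; the weights
       1 - s t and s t of F0 add up to 1. *)
    have comb (A B C : 'M[R]_nu) : F0 + ((1 - s * t) *: A + s *: (t *: B + C))
        = (1 - s * t) *: (F0 + A) + s *: (t *: (F0 + B) + C).
      have F0E : F0 = (1 - s * t) *: F0 + (s * t) *: F0.
        by rewrite -scalerDl subrK scale1r.
      rewrite {1}F0E addrACA -scalerDr; congr (_ + _).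
      by rewrite -scalerA -scalerDr addrA -scalerDr.
    rewrite !lmiE -comb; congr (_ + _).
    rewrite -(lin_linear t u 0 x xi) -(linZ s)
      -lin_linear scaler0 add0r; congr (lin _ _).
    rewrite scalerDr scalerA addrA -scalerDl; congr (_ + _).
    by rewrite subrK scale1r.
  rewrite quadD; apply: addr_ge0.
    by rewrite mulr_ge0// subr_ge0 ltW.
  by rewrite -scalemxAr -scalemxAl mxE mulr_ge0// ltW.
move=> /u_min[l].
have := sos_convex_gradient (u + s *: x) u (convex_g l).
have -> : \sum_(i < m) mpoly.meval ((u + s *: x) 0) (mpoly.mderiv i (g l)) *
    (u 0 i - (u + s *: x) 0 i) = - (s * slope (u + s *: x) l x).
  rewrite /slope mulr_sumr -sumrN; apply: eq_bigr => i _.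
  by rewrite [(u + s *: x) 0 i]mxE [(s *: x) 0 i]mxE; ring.
have := sE l; have := slopeS l; have := g_u l.
set G := mpoly.meval (u 0) (g l); set G' := mpoly.meval _ (g l).
set d := slope (u + _) l x; set d0 := slope u l x.
move=> Ggam dtau dd GG gamG.
have : (1 - s * t) * (gam - G) < 0.
  have : s * (d0 - tau) <= s * (- (t * (G - gam))).
    by rewrite ler_pM2l//; lra.
  have : s * d < s * (d0 - tau) by rewrite ltr_pM2l.
  nra.
by rewrite ltNge mulr_ge0// subr_ge0// ltW.
Unshelve. all: by end_near.
Qed.

Local Notation block := ('rV[R]_L * 'M[R]_nu * R^o)%type.

(** The matrix component ranges over all square matrices, symmetric or not;
    a functional that is nonnegative on this cone vanishes on the
    antisymmetric matrices. *)
Let cone : set block := [set p : block |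
  [/\ forall l, 0 <= p.1.1 0 l,
      forall y : 'cV[R]_nu, 0 <= (y^T *m p.1.2 *m y) 0 0 & 0 <= p.2]].

(** The slacks, at [(t, x, xi, tau)], of the system refuted by
    [no_descent_direction] when [tau < 0]. *)
Let constraint (t : R) x xi (tau : R) : block :=
  (\row_l (tau - (t * (mpoly.meval (u 0) (g l) - gam) + slope u l x)),
   t *: (F0 + lin u 0) + lin x xi, t).

Lemma cone_convex : convex_cone cone.
Proof.
split.
- by split=> [l|y|] /=; rewrite ?mulmx0 ?mul0mx ?mxE.
- move=> p q [p1 p2 p3] [q1 q2 q3]; split=> [l|y|] /=.
  + by rewrite mxE addr_ge0.
  + by rewrite -[p.1.2]scale1r quadD mul1r addr_ge0.
  + exact: addr_ge0.
- move=> a p a0 [p1 p2 p3]; split=> [l|y|] /=.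
  + by rewrite mxE mulr_ge0.
  + by rewrite -scalemxAr -scalemxAl mxE mulr_ge0.
  + exact: mulr_ge0.
Qed.

Lemma constraint_linear a t x xi tau t' x' xi' tau' :
  constraint (a * t + t') (a *: x + x') (a *: xi + xi') (a * tau + tau') =
  a *: constraint t x xi tau + constraint t' x' xi' tau'.
Proof.
congr (_, _, _).
  by apply/rowP => l; rewrite !mxE slope_linear; ring.
by rewrite /= lin_linear scalerDl addrACA -scalerA -scalerDr.
Qed.

Hypothesis slater : exists v xi, pdmx (lmi F0 F M v xi).

(** Slater's condition: moving from [u] towards the strictly feasible point,
    with [tau] large, gives strictly positive slacks, and a large multiple of
    these dominates any [z]. *)
Lemma constraint_order_unit z :
  exists t x xi tau, cone (constraint t x xi tau - z).
Proof.
have [v [xi pdA]] := slater; case: z => [[a S] b].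
have [s0 s0ge0 sS] := pdmx_order_unit S pdA.
pose viol l := mpoly.meval (u 0) (g l) - gam + slope u l (v - u).
pose tau := 1 + \sum_l `|viol l|.
pose s := s0 + (\sum_l `|a 0 l| + `|b|).
have le_sum (h : 'I_L -> R) l : h l <= \sum_l `|h l|.
  by rewrite (bigD1 l)//= (le_trans (ler_norm _))// lerDl sumr_ge0.
have suma0 : 0 <= \sum_l `|a 0 l| by rewrite sumr_ge0.
have s_ge0 : 0 <= s by rewrite !addr_ge0.
have cE : constraint s (s *: (v - u)) (s *: xi) (s * tau) =
          s *: constraint 1 (v - u) xi tau.
  have := constraint_linear s 1 (v - u) xi tau 0 0 0 0.
  rewrite !addr0 mulr1 => ->.
  suff -> : constraint 0 0 0 0 = 0 by rewrite addr0.
  have := constraint_linear (-1) 0 0 0 0 0 0 0 0.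
  by rewrite !mulr0 !scaler0 !addr0 scaleN1r addNr.
exists s, (s *: (v - u)), (s *: xi), (s * tau); rewrite cE; split=> [l|y|] /=.
- rewrite !mxE subr_ge0 mul1r -/(viol l).
  apply: (le_trans (le_sum (fun l => a 0 l) l)).
  apply: (@le_trans _ _ s); first by rewrite /s addrCA lerDl addr_ge0.
  by rewrite ler_peMr// /tau -addrA lerDl subr_ge0; exact: le_sum.
- have -> : 1 *: (F0 + lin u 0) + lin (v - u) xi = lmi F0 F M v xi.
    rewrite scale1r lmiE -addrA; congr (_ + _).
    have := lin_linear 1 u 0 (v - u) xi.
    by rewrite !scale1r add0r [u + _]addrC subrK => ->.
  rewrite quadD mulmxN mulNmx [X in _ + X]mxE subr_ge0.
  apply: (le_trans (sS y)); apply: ler_wpM2r; last by rewrite lerDl addr_ge0.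
  have [->|y0] := eqVneq y 0; first by rewrite mulmx0 mxE.
  by apply: ltW; apply: pdA.2.
- rewrite subr_ge0 [_ *: _]mulr1 (le_trans (ler_norm b))//.
  by rewrite /s addrA lerDr addr_ge0.
Qed.

(** By [no_descent_direction], [constraint t x xi tau |-> tau] is a positive
    functional on the range of [constraint]. Its Riesz extension to the whole
    space reads [(a, S, b) |-> sum_l a_l delta_l + tr (Z S) + b rho]. Comparing
    it with [tau] gives the conclusions: the coefficient of [tau] normalises
    [delta], those of [x] and [xi] are the stationarity equations, and the value
    at [t = 1], [x = 0], [tau = 0] and a witness [xi] for [u] is a sum of three
    nonnegative terms equal to 0, which is complementary slackness. *)
Lemma kkt_multipliers : exists (Z : 'M[R]_nu) (delta : 'rV[R]_L),
  [/\ psdmx Z /\ simplex delta,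
      \sum_l delta 0 l * mpoly.meval (u 0) (g l) = gam,
      forall i, \sum_l delta 0 l * mpoly.meval (u 0) (mpoly.mderiv i (g l))
                = \tr (Z *m F i),
      \tr (Z *m F0) + \sum_i u 0 i * \tr (Z *m F i) = 0 &
      forall t, \tr (Z *m M t) = 0].
Proof.
pose graph : set (block * R) := [set p | exists t x xi tau,
  p = (constraint t x xi tau, tau)].
have [||v r [t [x [xi [tau [-> ->]]]]] [K1 K2 K3]|z|Phi [PhiE Phi_ge0]] :=
  @riesz_extension R block cone graph.
- exact: cone_convex.
- split=> [|a v r w s].
    exists 0, 0, 0, 0; congr (_, _).
    have := constraint_linear (-1) 0 0 0 0 0 0 0 0.
    by rewrite !mulr0 !scaler0 !addr0 scaleN1r addNr => ->.
  move=> [t [x [xi [tau [-> ->]]]]] [t' [x' [xi' [tau' [-> ->]]]]].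
  exists (a * t + t'), (a *: x + x'), (a *: xi + xi'), (a * tau + tau').
  by rewrite constraint_linear.
- apply: (no_descent_direction K3 K2) => l.
  by have := K1 l; rewrite mxE subr_ge0.
- have [t [x [xi [tau K0]]]] := constraint_order_unit z.
  by exists (constraint t x xi tau), tau; split=> //; exists t, x, xi, tau.
pose delta : 'rV[R]_L := \row_l Phi (delta_mx 0 l, 0, 0).
pose Z : 'M[R]_nu := \matrix_(i, j) Phi (0, delta_mx j i, 0).
pose rho := Phi (0, 0, 1).
have Phi_row a : Phi (a, 0, 0) = \sum_l a 0 l * delta 0 l.
  rewrite {1}[a]row_sum_delta (big_morph (fun a => Phi (a, 0, 0)) (id1 := 0)
    (op1 := +%R)); first last.
  - exact: linear0.
  - by move=> b c; rewrite -linearD; congr (Phi (_, _, _)); rewrite addr0.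
  apply: eq_bigr => l _; rewrite mxE -[RHS]linearZ.
  by congr (Phi (_, _, _)); rewrite scaler0.
have Phi_mx S : Phi (0, S, 0) = \tr (Z *m S).
  pose psi (T : 'M[R]_nu) := Phi (0, T, 0).
  have psi0 : psi 0 = 0 by exact: linear0.
  have psiD A B : psi (A + B) = psi A + psi B.
    by rewrite /psi -linearD; congr (Phi (_, _, _)); rewrite addr0.
  rewrite -/(psi S) {1}[S]matrix_sum_delta (big_morph psi psiD psi0).
  rewrite [RHS](eq_bigr (fun i => \sum_j Z i j * S j i)); last first.
    by move=> i _; rewrite mxE.
  rewrite [RHS]exchange_big; apply: eq_bigr => i _ /=.
  rewrite (big_morph psi psiD psi0); apply: eq_bigr => j _.
  rewrite mxE mulrC -[RHS]linearZ.
  by congr (Phi (_, _, _)); rewrite scaler0.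
have Phi_split a S b :
    Phi (a, S, b) = \sum_l a 0 l * delta 0 l + \tr (Z *m S) + b * rho.
  rewrite -Phi_row -Phi_mx -[b * rho]linearZ -!linearD.
  by congr (Phi (_, _, _)); rewrite /= ?scaler0 ?addr0 ?add0r ?[_ *: _]mulr1.
have constraintE t x xi tau :
    \sum_l (tau - (t * (mpoly.meval (u 0) (g l) - gam) + slope u l x)) * delta 0 l
    + (t * \tr (Z *m (F0 + lin u 0)) + \tr (Z *m lin x xi)) + t * rho = tau.
  have PhiT : Phi (constraint t x xi tau) = tau.
    by apply: PhiE; exists t, x, xi, tau.
  rewrite -[RHS]PhiT {PhiT}.
  rewrite /constraint Phi_split.
  rewrite [in RHS]mulmxDr mxtraceD -scalemxAr mxtraceZ;
    congr (_ + _ + _).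
  by apply: eq_bigr => l _; congr (_ * _); rewrite mxE.
have delta_ge0 l : 0 <= delta 0 l.
  rewrite mxE; apply: Phi_ge0; split=> //= [k|y]; first by rewrite mxE ler0n.
  by rewrite mulmx0 mul0mx mxE.
have rho_ge0 : 0 <= rho.
  apply: Phi_ge0; split=> //= [k|y]; first by rewrite mxE.
  by rewrite mulmx0 mul0mx mxE.
have trZ_ge0 S : (forall y : 'cV[R]_nu, 0 <= (y^T *m S *m y) 0 0) ->
    0 <= \tr (Z *m S).
  by move=> posS; rewrite -Phi_mx; apply: Phi_ge0; split=> //= k; rewrite mxE.
have trZ_quad (y : 'cV[R]_nu) : \tr (Z *m (y *m y^T)) = (y^T *m Z *m y) 0 0.
  by rewrite mulmxA mxtrace_mulC mulmxA /mxtrace big_ord1.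
have slope0 l : slope u l 0 = 0.
  by rewrite /slope big1// => i _; rewrite mxE mulr0.
have lin0 : lin 0 0 = 0.
  by rewrite /lin !big1 ?addr0// => i _; rewrite mxE scale0r.
have sum_delta n (h : 'I_n -> R) (i : 'I_n) :
    \sum_j (delta_mx 0 i : 'rV_n) 0 j * h j = h i.
  rewrite (bigD1 i)//= big1 => [|j ji]; first by rewrite mxE !eqxx mul1r addr0.
  by rewrite mxE (negPf ji) andbF mul0r.
have trZ_lin x xi : \tr (Z *m lin x xi) =
    \sum_i x 0 i * \tr (Z *m F i) + \sum_t xi 0 t * \tr (Z *m M t).
  rewrite mulmxDr linearD /= !mulmx_sumr !linear_sum /=.
  by congr (_ + _); apply: eq_bigr => i _; rewrite -scalemxAr linearZ.
have trZM t : \tr (Z *m M t) = 0.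
  have := constraintE 0 0 (delta_mx 0 t) 0.
  rewrite trZ_lin sum_delta big1 => [|l _]; last first.
    by rewrite slope0 mul0r addr0 subr0 mul0r.
  by rewrite big1 => [|i _]; rewrite ?mxE ?mul0r// !add0r addr0.
have gradE i : \sum_l delta 0 l * mpoly.meval (u 0) (mpoly.mderiv i (g l))
                = \tr (Z *m F i).
  have := constraintE 0 (delta_mx 0 i) 0 0.
  rewrite trZ_lin sum_delta [X in _ + (_ + (_ + X))]big1 => [|t _]; last first.
    by rewrite mxE mul0r.
  rewrite !mul0r add0r !addr0 => /eqP; rewrite addrC addr_eq0 => /eqP ->.
  rewrite -sumrN; apply: eq_bigr => l _.
  rewrite mul0r !add0r mulNr opprK mulrC; congr (_ * _).
  rewrite -[LHS](sum_delta _ (fun i => mpoly.meval (u 0) (mpoly.mderiv i (g l)))).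
  by apply: eq_bigr => k _; rewrite mulrC.
have delta1 : \sum_l delta 0 l = 1.
  have := constraintE 0 0 0 1; rewrite lin0 mulmx0 mxtrace0 !mul0r !addr0.
  move=> <-; apply: eq_bigr => l _.
  by rewrite slope0 mul0r addr0 subr0 mul1r.
have [xiu [_ pos_u]] := Omega_u.
have slack1 : 0 <= \sum_l (gam - mpoly.meval (u 0) (g l)) * delta 0 l.
  by apply: sumr_ge0 => l _; rewrite mulr_ge0// subr_ge0.
have slack2 := trZ_ge0 _ pos_u.
have slackE : \sum_l (gam - mpoly.meval (u 0) (g l)) * delta 0 l +
    \tr (Z *m lmi F0 F M u xiu) + rho = 0.
  have := constraintE 1 0 xiu 0; rewrite !mul1r => sumE.
  rewrite -[RHS]sumE; congr (_ + _ + _).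
    by apply: eq_bigr => l _; rewrite slope0 mul1r addr0 sub0r opprB.
  rewrite -linearD -mulmxDr lmiE -addrA; congr (\tr (Z *m (_ + _))).
  by have := lin_linear 1 u 0 0 xiu; rewrite !scale1r addr0 add0r.
exists Z, delta; split=> //.
- split; last by split.
  split=> [|y]; last first.
    rewrite -trZ_quad; apply: trZ_ge0 => w.
    have -> : w^T *m (y *m y^T) *m w = (y^T *m w)^T *m (y^T *m w).
      by rewrite trmx_mul trmxK !mulmxA.
    by rewrite mxE big_ord1 mxE -expr2 sqr_ge0.
  apply/symmetricmxP/matrixP => i j; rewrite mxE.
  have ZE k l : Z k l = \tr (Z *m delta_mx l k) by rewrite -Phi_mx mxE.
  (* The form of delta_mx k l - delta_mx l k is zero. *)
  suff le_Z k l : Z k l <= Z l k by apply/le_anti; rewrite !le_Z.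
  rewrite -subr_ge0 !ZE -linearB -mulmxBr; apply: trZ_ge0 => y.
  have quadT : (y^T *m delta_mx k l *m y) 0 0 = (y^T *m delta_mx l k *m y) 0 0.
    transitivity ((y^T *m delta_mx k l *m y)^T 0 0).
      by rewrite [RHS]mxE.
    by rewrite !trmx_mul trmxK trmx_delta mulmxA.
  by rewrite mulmxBr mulmxBl mxE [X in _ + X]mxE quadT subrr.
- have : \sum_l (gam - mpoly.meval (u 0) (g l)) * delta 0 l = 0 by lra.
  under eq_bigr do rewrite mulrBl.
  rewrite sumrB -mulr_sumr delta1 mulr1 => /eqP; rewrite subr_eq0 => /eqP ->.
  by apply: eq_bigr => l _; rewrite mulrC.
- have : \tr (Z *m lmi F0 F M u xiu) = 0 by lra.
  rewrite lmiE mulmxDr linearD /= trZ_lin [X in _ + (_ + X)]big1 ?addr0//.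
  by move=> t _; rewrite trZM mulr0.
Qed.

End KKT.

(** * The SOS certificate *)

Lemma sosD (R : realType) m (p q : {mpoly R[m]}) : sos p -> sos q -> sos (p + q).
Proof. by move=> [s ->] [t ->]; exists (s ++ t); rewrite big_cat. Qed.

Lemma sosZ (R : realType) m a (p : {mpoly R[m]}) : 0 <= a -> sos p -> sos (a *: p).
Proof.
move=> a0 [s ->]; exists [seq Num.sqrt a *: q | q <- s].
rewrite big_map scaler_sumr; apply: eq_bigr => q _.
by rewrite exprZn sqr_sqrtr.
Qed.

Lemma sosC (R : realType) m a : 0 <= a -> sos (mpoly.mpolyC m a : {mpoly R[m]}).
Proof.
move=> a0; exists [:: mpoly.mpolyC m (Num.sqrt a)].
by rewrite big_seq1 -rmorphXn /= sqr_sqrtr.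
Qed.

Lemma sos_sum (R : realType) m L (p : 'I_L -> {mpoly R[m]}) :
  (forall l, sos (p l)) -> sos (\sum_l p l).
Proof.
move=> sosp; elim/big_ind: _ => [|q s|l _]; [|exact: sosD|exact: sosp].
by exists [::]; rewrite big_nil.
Qed.

Lemma mdegree_affine_shift (R : realType) m L (g : 'I_L -> {mpoly R[m]})
    (delta : 'rV[R]_L) c (b : 'I_m -> R) n :
  (1 <= n)%N -> (forall l, mdegree (g l) <= n)%N ->
  (mdegree (\sum_l delta 0 l *: g l - mpoly.mpolyC m c
     - \sum_i b i *: mpoly.mpolyX R (mpoly.mnm1 i))%R <= n)%N.
Proof.
move=> n1 gn.
have D p q : (mpoly.msize p <= n.+1 -> mpoly.msize q <= n.+1 ->
    mpoly.msize (p + q : {mpoly R[m]})%R <= n.+1)%N.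
  by move=> sp sq; rewrite (leq_trans (mpoly.msizeD_le _ _))// geq_max sp sq.
have Z a p : (mpoly.msize p <= n.+1 -> mpoly.msize (a *: p : {mpoly R[m]})%R <= n.+1)%N.
  exact: leq_trans (mpoly.msizeZ_le _ _).
have S k (h : 'I_k -> {mpoly R[m]}) : (forall i, mpoly.msize (h i) <= n.+1)%N ->
    (mpoly.msize (\sum_i h i)%R <= n.+1)%N.
  move=> sh; elim/big_ind: _ => [|p q|i _]; [by rewrite mpoly.msize0|exact: D|exact: sh].
rewrite /mdegree -subn1 leq_subLR add1n.
have N p : (mpoly.msize p <= n.+1 -> mpoly.msize (- p : {mpoly R[m]})%R <= n.+1)%N.
  by rewrite mpoly.msizeN.
apply: (D); [apply: (D)|apply: (N)]; [apply: (S) => l|apply: (N)|apply: (S) => i].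
- by apply: (Z); rewrite (leq_trans (leqSpred _))// ltnS; exact: gn.
- by rewrite mpoly.msizeC; case: (c != 0).
- by apply: (Z); rewrite mpoly.msizeX mpoly.mdeg1.
Qed.

Lemma sum_simplex_ge0 (R : realType) L (delta : 'rV[R]_L) (h : 'I_L -> R) :
  simplex delta -> 0 <= \sum_l delta 0 l * h l -> exists l, 0 <= h l.
Proof.
move=> [delta_ge0 delta1] sum_ge0; apply: contrapT => /forallNP hneg.
have hlt l : h l < 0 by rewrite ltNge; apply/negP; exact: hneg.
have term_ge0 l : 0 <= delta 0 l * - h l.
  by rewrite mulr_ge0// oppr_ge0 ltW.
have sum0 : \sum_l delta 0 l * - h l = 0.
  apply/le_anti; rewrite sumr_ge0// andbT.
  by under eq_bigr do rewrite mulrN; rewrite sumrN oppr_le0.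
have : \sum_l delta 0 l = 0.
  apply: big1 => l _; have := psumr_eq0P (fun l _ => term_ge0 l) sum0 (i := l) isT.
  by move/eqP; rewrite mulf_eq0 oppr_eq0 (lt_eqF (hlt l)) orbF => /eqP.
by rewrite delta1 => /eqP; rewrite oner_eq0.
Qed.

Lemma min_max_ge0P (R : realType) r L (h : 'I_L -> 'I_r -> R) :
  (0 <= \big[Order.min/+oo]_(k < r) \big[Order.max/-oo]_(l < L) (h l k)%:E)%E
  <-> forall k, exists l, 0 <= h l k.
Proof.
split=> [/bigmin_geP[_ H] k|H].
  by have /bigmax_geP[//|[l _]] := H k isT; rewrite lee_fin; exists l.
apply/bigmin_geP; split=> [|k _]; first exact: leey.
by have [l hl] := H k; apply/bigmax_geP; right; exists l; rewrite ?lee_fin.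
Qed.

Lemma mxtrace_lmi (R : realType) m nu N (Z F0 : 'M[R]_nu) (F : 'I_m -> 'M[R]_nu)
    (M : 'I_N -> 'M[R]_nu) v xi :
  (forall t, \tr (Z *m M t) = 0) ->
  \tr (Z *m lmi F0 F M v xi) =
  \tr (Z *m F0) + \sum_i v 0 i * \tr (Z *m F i).
Proof.
move=> ZM; rewrite /lmi !mulmxDr !mxtraceD !mulmx_sumr !linear_sum /=.
rewrite [X in _ + X]big1 => [|t _]; last by rewrite -scalemxAr mxtraceZ ZM mulr0.
by rewrite addr0; congr (_ + _); apply: eq_bigr => i _; rewrite -scalemxAr mxtraceZ.
Qed.

(** At a minimax point [u] with value [gam], stationarity makes the linear parts
    of the tangents add up to the trace terms, and complementarity fixes the
    constants, so that the certificate polynomial is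
    [sum_l delta_l (g_l - tangent of g_l at u) + gam] with [gam >= 0]. *)
Lemma sos_certificate (R : realType) (m L nu N : nat)
    (F0 : 'M[R]_nu) (F : 'I_m -> 'M[R]_nu) (M : 'I_N -> 'M[R]_nu)
    (hF0 : F0 \is symmetricmx) (hF : forall i, F i \is symmetricmx)
    (hM : forall t, M t \is symmetricmx)
    (g : 'I_L -> {mpoly R[m]}) (hg : forall l, sos_convex (g l)) :
  (0 < L)%N -> compact (Omega F0 F M) ->
  (exists v xi, pdmx (lmi F0 F M v xi)) ->
  (forall v, Omega F0 F M v -> exists l, 0 <= mpoly.meval (v 0) (g l)) ->
  exists (Z : 'M[R]_nu) (delta : 'rV[R]_L),
    [/\ psdmx Z, simplex delta,
        sos (\sum_(l < L) delta 0 l *: g l - mpoly.mpolyC m (\tr (Z *m F0))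
             - \sum_(i < m) \tr (Z *m F i) *: mpoly.mpolyX R (mpoly.mnm1 i))
      & forall t, \tr (Z *m M t) = 0].
Proof.
move=> L0 cOmega slater g_ge0.
have Omega0 : Omega F0 F M !=set0.
  have [v [xi [symA posA]]] := slater; exists v, xi; split=> // x.
  have [->|x0] := eqVneq x 0; last exact/ltW/posA.
  by rewrite mulmx0 mxE.
have [u [gam [uOmega g_u u_min]]] :=
  compact_min_max L0 Omega0 cOmega (fun l => @meval_continuous _ _ (g l)).
have gam_ge0 : 0 <= gam by have [l /le_trans] := g_ge0 u uOmega; apply.
have [Z [delta [[psdZ simplexd] gamE gradE trace0 ZM]]] :=
  kkt_multipliers hF0 hF hM hg uOmega g_u u_min slater.
exists Z, delta; split=> //.
pose X i : {mpoly R[m]} := mpoly.mpolyX R (mpoly.mnm1 i).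
pose C : {rmorphism R -> {mpoly R[m]}} := @mpoly.mpolyC m R.
pose tangent l := g l - C (mpoly.meval (u 0) (g l))
  - \sum_(i < m) mpoly.meval (u 0) (mpoly.mderiv i (g l)) *: (X i - C (u 0 i)).
suff -> : \sum_(l < L) delta 0 l *: g l - mpoly.mpolyC m (\tr (Z *m F0))
    - \sum_(i < m) \tr (Z *m F i) *: mpoly.mpolyX R (mpoly.mnm1 i)
  = \sum_l delta 0 l *: tangent l + C gam.
  apply: sosD; last exact: sosC.
  apply: sos_sum => l; apply: sosZ; first exact: simplexd.1.
  exact: sos_convex_tangent.
have tangentE : \sum_l delta 0 l *: tangent l = \sum_l delta 0 l *: g l - C gam
    - \sum_i \tr (Z *m F i) *: (X i - C (u 0 i)).
  under eq_bigr do rewrite !scalerBr.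
  rewrite !sumrB; congr (_ - _ - _).
    rewrite -gamE raddf_sum /=; apply: eq_bigr => l _.
    by rewrite -mpoly.mul_mpolyC rmorphM.
  under eq_bigr do rewrite scaler_sumr.
  rewrite exchange_big; apply: eq_bigr => i _ /=.
  by rewrite -gradE scaler_suml; apply: eq_bigr => l _; rewrite scalerA.
rewrite tangentE; under [X in _ = _ - X + _]eq_bigr do rewrite scalerBr.
rewrite sumrB -/(C _).
have -> : \sum_i \tr (Z *m F i) *: C (u 0 i) = - C (\tr (Z *m F0)).
  rewrite -rmorphN; have /eqP := trace0; rewrite addr_eq0 => /eqP ->.
  rewrite opprK.
  rewrite raddf_sum; apply: eq_bigr => i _.
  by rewrite [u 0 i * _]mulrC [RHS]rmorphM /= mpoly.mul_mpolyC.
by rewrite /X; ring.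
Qed.

Theorem theorem2p4 (R : realType) (m L r nu N : nat)
    (hm : (1 <= m)%N) (hL : (1 <= L)%N) (hr : (1 <= r)%N) (hnu : (1 <= nu)%N)
    (F0 : 'M[R]_nu) (F : 'I_m -> 'M[R]_nu) (M : 'I_N -> 'M[R]_nu)
    (hF0 : F0 \is symmetricmx) (hF : forall i, F i \is symmetricmx)
    (hM : forall t, M t \is symmetricmx)
    (g : 'I_L -> 'I_r -> {mpoly R[m]})
    (hg : forall l k, sos_convex (g l k))
    (hcompact : compact (Omega F0 F M))
    (hslater : exists (vbar : 'rV[R]_m) (xibar : 'rV[R]_N),
       pdmx (lmi F0 F M vbar xibar))
    (d : nat)
    (hd : smallest_even_above
            (\max_(k < r) \max_(l < L) mdegree (g l k)) d) :
  (forall v : 'rV[R]_m, Omega F0 F M v ->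
     (0 <= \big[Order.min/+oo]_(k < r)
             \big[Order.max/-oo]_(l < L) (mpoly.meval (v 0) (g l k))%:E)%E)
  <->
  (forall k : 'I_r, exists (Z : 'M[R]_nu) (delta : 'rV[R]_L),
     [/\ psdmx Z,
         simplex delta,
         sos_deg d (\sum_(l < L) delta 0 l *: g l k
                    - mpoly.mpolyC m (\tr (Z *m F0))
                    - \sum_(i < m) \tr (Z *m F i) *: mpoly.mpolyX R (mpoly.mnm1 i))
       & forall t : 'I_N, \tr (Z *m M t) = 0]).
Proof.
have [d_even Dd _] := hd.
have d1 : (1 <= d)%N by exact: leq_ltn_trans Dd.
have hP v := @min_max_ge0P R r L (fun l k => mpoly.meval (v 0) (g l k)).
split=> [H k|H v [xi psdv]].
  have [|Z [delta [psdZ simplexd sosp ZM]]] :=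
    sos_certificate hF0 hF hM (hg ^~ k) hL hcompact hslater.
    by move=> v /H/hP.
  exists Z, delta; split=> //; split=> //; apply: mdegree_affine_shift => // l.
  apply: leq_trans (ltnW Dd).
  apply: (leq_trans _ (leq_bigmax k)); exact: (leq_bigmax l).
apply/hP => k.
have [Z [delta [psdZ simplexd [/(@sos_meval_ge0 _ _ _ (v 0)) sosp _] ZM]]] := H k.
apply: (sum_simplex_ge0 simplexd).
have := mxtrace_psdmx_ge0 psdZ psdv; rewrite mxtrace_lmi//.
move: sosp; rewrite !mpoly.mevalB mpoly.mevalC.
rewrite [X in X - _ - _]raddf_sum [X in _ - X]raddf_sum /=.
under eq_bigr do rewrite mpoly.mevalZ.
under [X in _ - X]eq_bigr do rewrite mpoly.mevalZ mpoly.mevalXU mulrC.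
lra.
Qed.
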